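(* For every finite set $\mathcal A\subset\mathbb{R}^d$ and every sequence $\{w_i\mid i\in\mathbb{N}\}$ in $\mathbb{R}^{\mathcal A}_>$, there exist a subsequence $\{u_j\mid j\in\mathbb{N}\}$ of $\{w_i\}$, a regular subdivision $\mathcal S$ of $\mathcal A$, and $w\in\mathbb{R}^{\mathcal A}_>$ such that $\lim_{j\to\infty}u_j.X_{\mathcal A}=X(\mathcal S,w)$ in the Hausdorff topology on closed subsets of $\Delta^{\mathcal A}$.
   Context: $\Delta^{\mathcal A}=\{z\in\mathbb{R}_{\ge0}^{\mathcal A}\mid\sum_{\mathbf a}z_{\mathbf a}=1\}$, with homogeneous coordinates $[z_{\mathbf a}\mid\mathbf a\in\mathcal A]$ and the $\ell_1$ metric; the Hausdorff distance between closed sets $X,Y$ is $\max\{\sup_{x\in X}\inf_{y\in Y}d(x,y),\sup_{y\in Y}\inf_{x\in X}d(x,y)\}$. For $\mathcal F\subset\mathcal A$, $\Delta^{\mathcal F}$ is the face of $\Delta^{\mathcal A}$ with $z_{\mathbf a}=0$ for $\mathbf a\notin\mathcal F$. For $x\in\mathbb{R}^d_>$, $x^{\mathbf a}=\prod_j\exp(\mathbf a_j\log x_j)$. The real irrational toric variety $X_{\mathcal A}$ is the closure of $\{[x^{\mathbf a}\mid\mathbf a\in\mathcal A]\mid x\in\mathbb{R}^d_>\}$ in $\Delta^{\mathcal A}$; $u\in\mathbb{R}^{\mathcal A}_>$ acts by $u.z=[u_{\mathbf a}z_{\mathbf a}]$. For $w\in\mathbb{R}^{\mathcal A}_>$ and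 $\mathcal F\subset\mathcal A$, $X_{\mathcal F,w}$ is the closure in $\Delta^{\mathcal F}$ of $\{[w_{\mathbf f}x^{\mathbf f}\mid\mathbf f\in\mathcal F]\mid x\in\mathbb{R}^d_>\}$. A regular subdivision of $\mathcal A$ is one of the form $\mathcal S_\lambda$, $\lambda\in\mathbb{R}^{\mathcal A}$: with $P_\lambda=\mathrm{conv}\{(\mathbf a,\lambda(\mathbf a))\}$, whose upper faces are the faces with an outward normal having positive last coordinate, the faces of $\mathcal S_\lambda$ are the sets $\{\mathbf a\mid(\mathbf a,\lambda(\mathbf a))\in F\}$ for upper faces $F$. The complex of toric varieties is $X(\mathcal S,w)=\bigcup_{\mathcal F\text{ a face of }\mathcal S}X_{\mathcal F,w}$. *)

(* Defs.v *)
From Stdlib Require Import Reals.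
Open Scope R_scope.

(* Conventions.
   - d : dimension of the ambient space R^d; a point a of R^d is a function
     nat -> R whose coordinates j < d are meaningful.
   - The finite set A = {a_0,...,a_{n-1}} is given as A : nat -> (nat -> R),
     A k being the k-th point (k < n); the points are required to be distinct.
   - Elements of R^A are functions z : nat -> R, only coordinates k < n matter.
   - A subset F of A is a boolean predicate F : nat -> bool on indices. *)

Fixpoint rsum (n : nat) (f : nat -> R) : R :=
  match n with O => 0 | S m => rsum m f + f m end.

Definition l1dist (n : nat) (z y : nat -> R) : R :=
  rsum n (fun k => Rabs (z k - y k)).

Definition in_simplex (n : nat) (z : nat -> R) : Prop :=
  (forall k, (k < n)%nat -> 0 <= z k) /\ rsum n z = 1.

Definition in_face (n : nat) (F : nat -> bool) (z : nat -> R) : Prop :=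
  in_simplex n z /\ (forall k, (k < n)%nat -> F k = false -> z k = 0).

Definition pos_vec (d : nat) (x : nat -> R) : Prop :=
  forall j, (j < d)%nat -> 0 < x j.

(* x^a = prod_j exp(a_j log x_j) = exp(sum_j a_j log x_j) *)
Definition mono (d : nat) (a x : nat -> R) : R :=
  exp (rsum d (fun j => a j * ln (x j))).

Definition closure_in (n : nat) (ambient S : (nat -> R) -> Prop) (z : nat -> R)
  : Prop :=
  ambient z /\ forall eps, 0 < eps -> exists y, S y /\ l1dist n z y < eps.

(* homogeneous coordinates [w_f x^f | f in F] (zero outside F) *)
Definition param (d n : nat) (A : nat -> nat -> R) (F : nat -> bool)
  (w x : nat -> R) : nat -> R :=
  fun k => if F k then w k * mono d (A k) x /
             rsum n (fun m => if F m then w m * mono d (A m) x else 0)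
           else 0.

Definition X_Fw (d n : nat) (A : nat -> nat -> R) (F : nat -> bool)
  (w : nat -> R) : (nat -> R) -> Prop :=
  closure_in n (in_face n F)
    (fun y => exists x, pos_vec d x /\ y = param d n A F w x).

Definition X_A (d n : nat) (A : nat -> nat -> R) : (nat -> R) -> Prop :=
  X_Fw d n A (fun _ => true) (fun _ => 1).

Definition act (n : nat) (u z : nat -> R) : nat -> R :=
  fun k => u k * z k / rsum n (fun m => u m * z m).

Definition act_set (n : nat) (u : nat -> R) (X : (nat -> R) -> Prop)
  : (nat -> R) -> Prop :=
  fun y => exists z, X z /\ forall k, (k < n)%nat -> y k = act n u z k.

(* Faces of the regular subdivision S_lambda.  An upper face of
   P_lambda = conv{(a_k, lambda_k)} is the set of maximizers on P_lambda of a
   linear functional (c, c0) with c0 > 0 (rescaled to c0 = 1); the lifted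
   points lying on it are exactly the maximizers among the (a_k, lambda_k).
   So F is a face of S_lambda iff, for some c in R^d, F is the set of indices
   k < n maximizing <c, a_k> + lambda_k. *)
Definition lin_val (d : nat) (A : nat -> nat -> R) (lam c : nat -> R) (k : nat)
  : R := rsum d (fun j => c j * A k j) + lam k.

Definition reg_face (d n : nat) (A : nat -> nat -> R) (lam : nat -> R)
  (F : nat -> bool) : Prop :=
  exists c : nat -> R,
    (forall k, (k >= n)%nat -> F k = false) /\
    forall k, (k < n)%nat ->
      (F k = true <->
       forall m, (m < n)%nat -> lin_val d A lam c m <= lin_val d A lam c k).

Definition X_complex (d n : nat) (A : nat -> nat -> R) (lam w : nat -> R)
  : (nat -> R) -> Prop :=
  fun z => exists F, reg_face d n A lam F /\ X_Fw d n A F w z.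

(* Hausdorff convergence: the Hausdorff distance between Y_j and Y tends to 0,
   written out with eps-neighbourhoods (d_H(X,Y) < eps implies each set lies in
   the eps-neighbourhood of the other, which implies d_H(X,Y) <= eps). *)
Definition hausdorff_lim (n : nat) (Ys : nat -> (nat -> R) -> Prop)
  (Y : (nat -> R) -> Prop) : Prop :=
  forall eps, 0 < eps -> exists N, forall j, (N <= j)%nat ->
    (forall y, Ys j y -> exists x, Y x /\ l1dist n y x < eps) /\
    (forall x, Y x -> exists y, Ys j y /\ l1dist n x y < eps).

(* Main.v *)
Require Import Defs.
From Stdlib Require Import Reals Lra Lia List Classical IndefiniteDescription.
From Coquelicot Require Import Coquelicot.
Import ListNotations.
Open Scope R_scope.

(** Write [v_j = log w_j].  For a subset F of A, the set of heights y for which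
    F lies on a common supporting hyperplane of the lifted points (a "weak face")
    is a polyhedral cone, by Fourier-Motzkin elimination of the hyperplane; let Q
    collect the linear forms cutting out these cones for all F.  Pass to a
    subsequence along which every form of Q has a limit in [-oo, +oo] on [v_j].
    Some convergent sequence [corr_j -> log w] agrees with [v_j] on all forms with
    a finite limit, so for J large [lam = v_J - corr_J] vanishes on those forms and
    has the sign of the limit on the others.  Consequently F is a face of the
    subdivision of [lam] exactly when, along the subsequence, F can be lifted to a
    common supporting hyperplane of [v_j - corr_j] with the other points
    arbitrarily far below; this yields both inclusions of the limit, and
    compactness of the simplex makes them uniform. *)

(** * Finite sums and linear forms *)

Lemma rsum_ext n (f g : nat -> R) :
  (forall k, (k < n)%nat -> f k = g k) -> rsum n f = rsum n g.
Proof.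
  induction n as [|n IH]; simpl; intros H; [easy|].
  rewrite IH, (H n); auto.
Qed.

Lemma rsum_plus n (f g : nat -> R) :
  rsum n (fun k => f k + g k) = rsum n f + rsum n g.
Proof. induction n as [|n IH]; simpl; [|rewrite IH]; ring. Qed.

Lemma rsum_scal n (a : R) (f : nat -> R) :
  rsum n (fun k => a * f k) = a * rsum n f.
Proof. induction n as [|n IH]; simpl; [|rewrite IH]; ring. Qed.

Lemma rsum_le n (f g : nat -> R) :
  (forall k, (k < n)%nat -> f k <= g k) -> rsum n f <= rsum n g.
Proof.
  induction n as [|n IH]; simpl; intros H; [lra|].
  specialize (H n (Nat.lt_succ_diag_r n)) as H1.
  assert (rsum n f <= rsum n g) by auto. lra.
Qed.

Lemma rsum_0 n : rsum n (fun _ => 0) = 0.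
Proof. induction n as [|n IH]; simpl; [|rewrite IH]; ring. Qed.

Lemma rsum_ge_term n (f : nat -> R) k :
  (forall i, (i < n)%nat -> 0 <= f i) -> (k < n)%nat -> f k <= rsum n f.
Proof.
  induction n as [|n IH]; simpl; intros H Hk; [lia|].
  assert (H0 : 0 <= rsum n f).
  { rewrite <- (rsum_0 n). apply rsum_le. auto. }
  specialize (H n (Nat.lt_succ_diag_r n)) as H1.
  destruct (Nat.eq_dec k n) as [->|Hn]; [lra|].
  assert (f k <= rsum n f) by (apply IH; [auto|lia]). lra.
Qed.

Lemma is_lim_seq_rsum n (u : nat -> nat -> R) (l : nat -> R) :
  (forall k, (k < n)%nat -> is_lim_seq (fun j => u j k) (l k)) ->
  is_lim_seq (fun j => rsum n (u j)) (rsum n l).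
Proof.
  induction n as [|n IH]; simpl; intros H.
  - apply is_lim_seq_const.
  - apply is_lim_seq_plus'; [apply IH|apply H]; auto.
Qed.

Definition dot (n : nat) (p y : nat -> R) : R := rsum n (fun k => p k * y k).

Lemma dot_ext n (p q y z : nat -> R) :
  (forall k, (k < n)%nat -> p k = q k) -> (forall k, (k < n)%nat -> y k = z k) ->
  dot n p y = dot n q z.
Proof. intros H1 H2. apply rsum_ext. intros k Hk. now rewrite H1, H2. Qed.

Lemma dot_plus_r n (p y z : nat -> R) :
  dot n p (fun k => y k + z k) = dot n p y + dot n p z.
Proof.
  unfold dot. rewrite <- rsum_plus. apply rsum_ext. intros; ring.
Qed.

Lemma dot_scal_r n (p y : nat -> R) (t : R) :
  dot n p (fun k => t * y k) = t * dot n p y.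
Proof.
  unfold dot. rewrite <- rsum_scal. apply rsum_ext. intros; ring.
Qed.

Lemma dot_comm n (p y : nat -> R) : dot n p y = dot n y p.
Proof. apply rsum_ext. intros; ring. Qed.

Lemma dot_lincomb_l n (p q y : nat -> R) (s t : R) :
  dot n (fun k => s * p k + t * q k) y = s * dot n p y + t * dot n q y.
Proof.
  unfold dot. rewrite <- !rsum_scal, <- rsum_plus. apply rsum_ext. intros; ring.
Qed.

Lemma dot_0_l n (y : nat -> R) : dot n (fun _ => 0) y = 0.
Proof.
  unfold dot. transitivity (rsum n (fun _ => 0)); [|apply rsum_0].
  apply rsum_ext. intros; ring.
Qed.

Lemma dot_indicator n (y : nat -> R) k :
  (k < n)%nat -> dot n (fun i => if Nat.eqb i k then 1 else 0) y = y k.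
Proof.
  unfold dot. induction n as [|n IH]; simpl; intros Hk; [lia|].
  destruct (Nat.eqb_spec n k) as [<-|Hn].
  - rewrite (rsum_ext n _ (fun _ => 0)), rsum_0; [ring|].
    intros i Hi. destruct (Nat.eqb_spec i n); [lia|ring].
  - rewrite IH by lia. ring.
Qed.

Lemma is_lim_seq_dot n (p : nat -> R) (u : nat -> nat -> R) (l : nat -> R) :
  (forall k, (k < n)%nat -> is_lim_seq (fun j => u j k) (l k)) ->
  is_lim_seq (fun j => dot n p (u j)) (dot n p l).
Proof.
  intros H. unfold dot. apply is_lim_seq_rsum. intros k Hk.
  apply (is_lim_seq_scal_l (fun j => u j k) (p k) (l k)). auto.
Qed.

(** * Fourier-Motzkin elimination *)

Lemma between_lists (L U : list R) :
  (forall l u, In l L -> In u U -> l <= u) ->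
  exists t, (forall l, In l L -> l <= t) /\ (forall u, In u U -> t <= u).
Proof.
  induction L as [|a L IHL]; intros H.
  - clear H. induction U as [|b U [t [_ Ht]]].
    + exists 0. split; intros ? [].
    + exists (Rmin t b). split; [intros ? []|].
      intros u [->|Hu]; [apply Rmin_r|].
      eapply Rle_trans; [apply Rmin_l|auto].
  - destruct IHL as [t [H1 H2]]; [intros; apply H; simpl; auto|].
    exists (Rmax t a). split.
    + intros l [->|Hl]; [apply Rmax_r|].
      eapply Rle_trans; [|apply Rmax_l]. auto.
    + intros u Hu. apply Rmax_lub; [auto|]. apply H; simpl; auto.
Qed.

(** A constraint with [b q > 0] bounds [t] above by [- a q / b q], one with [b q < 0] bounds it
    below, and one with [b q = 0] does not involve [t]. A solution exists iff every lower bound is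
    at most every upper bound; clearing the positive factor [b p * - b q] gives the last
    condition. *)
Lemma affine_system_1d {I : Type} (Q : list I) (a b : I -> R) :
  (exists t, forall q, In q Q -> a q + b q * t <= 0) <->
  (forall q, In q Q -> b q = 0 -> a q <= 0) /\
  (forall p q, In p Q -> In q Q -> 0 < b p -> b q < 0 ->
     b p * a q + - b q * a p <= 0).
Proof.
  split.
  - intros [t Ht]. split.
    + intros q Hq Hb. specialize (Ht q Hq). rewrite Hb in Ht. lra.
    + intros p q Hp Hq Hbp Hbq.
      pose proof (Ht p Hp). pose proof (Ht q Hq). nra.
  - intros [H0 H].
    set (isp q := if Rlt_dec 0 (b q) then true else false).
    set (isn q := if Rlt_dec (b q) 0 then true else false).
    destruct (between_lists (map (fun q => - a q / b q) (filter isn Q))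
                            (map (fun q => - a q / b q) (filter isp Q)))
      as [t [H1 H2]].
    { intros l u Hl Hu.
      apply in_map_iff in Hl as [q [<- Hq]]. apply in_map_iff in Hu as [p [<- Hp]].
      apply filter_In in Hq as [Hq Hbq]. apply filter_In in Hp as [Hp Hbp].
      unfold isn in Hbq. destruct (Rlt_dec (b q) 0) as [Hq'|]; [|easy].
      unfold isp in Hbp. destruct (Rlt_dec 0 (b p)) as [Hp'|]; [|easy].
      pose proof (H p q Hp Hq Hp' Hq') as Hpq.
      assert (- a p / b p - - a q / b q =
              - (b p * a q + - b q * a p) / (b p * - b q)) as E
        by (field; lra).
      assert (0 <= - (b p * a q + - b q * a p) / (b p * - b q)).
      { apply Rdiv_le_0_compat; [lra|nra]. }
      lra. }
    exists t. intros q Hq.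
    destruct (Rtotal_order (b q) 0) as [Hb|[Hb|Hb]].
    + assert (Ht : - a q / b q <= t).
      { apply H1, in_map_iff. exists q. split; [easy|].
        apply filter_In. split; [easy|]. unfold isn.
        now destruct (Rlt_dec (b q) 0). }
      assert (a q = - (- a q / b q) * b q) as E by (field; lra). nra.
    + rewrite Hb, Rmult_0_l, Rplus_0_r. auto.
    + assert (Ht : t <= - a q / b q).
      { apply H2, in_map_iff. exists q. split; [easy|].
        apply filter_In. split; [easy|]. unfold isp.
        now destruct (Rlt_dec 0 (b q)). }
      assert (a q = - (- a q / b q) * b q) as E by (field; lra). nra.
Qed.

Lemma eliminate_last_variable n d (Q : list ((nat -> R) * (nat -> R))) :
  exists Q1 : list ((nat -> R) * (nat -> R)), forall y c,
    (exists t, forall q, In q Q ->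
       dot n (fst q) y + dot d (snd q) c + snd q d * t <= 0) <->
    (forall q, In q Q1 -> dot n (fst q) y + dot d (snd q) c <= 0).
Proof.
  (* The trivial form [z] fills the slots where no constraint arises, since it only asserts
     [0 <= 0]. In [r] the positive combination of [p] and [q] is the one whose coefficient at index
     [d] cancels. *)
  set (z := ((fun _ : nat => 0), (fun _ : nat => 0))).
  set (e := fun q : (nat -> R) * (nat -> R) => if Req_dec_T (snd q d) 0 then q else z).
  set (r := fun pq : ((nat -> R) * (nat -> R)) * ((nat -> R) * (nat -> R)) =>
     let (p, q) := pq in
     if Rlt_dec 0 (snd p d) then if Rlt_dec (snd q d) 0 then
       (fun k => snd p d * fst q k + - snd q d * fst p k,
        fun k => snd p d * snd q k + - snd q d * snd p k) else z else z).
  exists (map e Q ++ map r (list_prod Q Q)). intros y c.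
  assert (Hz : dot n (fst z) y + dot d (snd z) c <= 0).
  { simpl. rewrite !dot_0_l. lra. }
  rewrite (affine_system_1d Q (fun q => dot n (fst q) y + dot d (snd q) c)
             (fun q => snd q d)).
  split.
  - intros [H0 H] q Hq. apply in_app_or in Hq as [Hq|Hq].
    + apply in_map_iff in Hq as [p [<- Hp]]. unfold e.
      destruct Req_dec_T; auto.
    + apply in_map_iff in Hq as [[p q'] [<- Hp]].
      apply in_prod_iff in Hp as [Hp Hq]. unfold r.
      destruct Rlt_dec as [H1|]; [|exact Hz].
      destruct Rlt_dec as [H2|]; [|exact Hz].
      cbn [fst snd]. rewrite !dot_lincomb_l.
      specialize (H p q' Hp Hq H1 H2). lra.
  - intros H. split.
    + intros q Hq Hb. assert (Hq' : In (e q) (map e Q ++ map r (list_prod Q Q))).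
      { apply in_or_app. left. now apply in_map. }
      specialize (H _ Hq'). unfold e in H. destruct Req_dec_T; easy.
    + intros p q Hp Hq H1 H2.
      assert (Hq' : In (r (p, q)) (map e Q ++ map r (list_prod Q Q))).
      { apply in_or_app. right. apply in_map. now apply in_prod. }
      specialize (H _ Hq'). unfold r in H.
      destruct Rlt_dec; [|easy]. destruct Rlt_dec; [|easy].
      cbn [fst snd] in H. rewrite !dot_lincomb_l in H. lra.
Qed.

(** A projection of a polyhedral cone is polyhedral: the coordinates of [c] are eliminated one at a
    time, the last one first. *)
Lemma fourier_motzkin n d (Q : list ((nat -> R) * (nat -> R))) :
  exists P : list (nat -> R), forall y,
    (exists c, forall q, In q Q -> dot n (fst q) y + dot d (snd q) c <= 0) <->
    (forall p, In p P -> dot n p y <= 0).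
Proof.
  revert Q. induction d as [|d IH]; intros Q.
  - exists (map fst Q). intros y. split.
    + intros [c H] p Hp. apply in_map_iff in Hp as [q [<- Hq]].
      specialize (H q Hq). cbn in H. lra.
    + intros H. exists (fun _ => 0). intros q Hq. cbn.
      specialize (H (fst q) (in_map fst _ _ Hq)). lra.
  - destruct (eliminate_last_variable n d Q) as [Q1 H1].
    destruct (IH Q1) as [P HP]. exists P. intros y. rewrite <- HP. split.
    + intros [c H]. exists c. apply H1. exists (c d). intros q Hq.
      specialize (H q Hq). unfold dot in *. cbn in H. lra.
    + intros [c H]. apply H1 in H as [t H].
      exists (fun k => if Nat.eqb k d then t else c k). intros q Hq.
      specialize (H q Hq). unfold dot in *. cbn. rewrite Nat.eqb_refl.
      rewrite (rsum_ext d _ (fun k => snd q k * c k)); [lra|].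
      intros k Hk. destruct (Nat.eqb_spec k d); [lia|easy].
Qed.

(** * Weak faces *)

(** The hyperplane has slope [c] and level [M]. Points outside [F] may touch it too, and [F] may be
    empty; only non-strict inequalities occur, so [c] and [M] can be eliminated. *)
Definition weak_face (d n : nat) (A : nat -> nat -> R) (F : nat -> bool)
  (y : nat -> R) : Prop :=
  exists c M, forall k, (k < n)%nat ->
    dot d c (A k) + y k <= M /\ (F k = true -> M <= dot d c (A k) + y k).

Lemma weak_face_ext d n A (F G : nat -> bool) (y : nat -> R) :
  (forall k, (k < n)%nat -> F k = G k) ->
  weak_face d n A F y -> weak_face d n A G y.
Proof.
  intros H [c [M HM]]. exists c, M. intros k Hk. rewrite <- H by easy. auto.
Qed.

Definition cuts_weak_face (d n : nat) (A : nat -> nat -> R) (F : nat -> bool)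
  (P : list (nat -> R)) : Prop :=
  forall y, weak_face d n A F y <-> (forall p, In p P -> dot n p y <= 0).

Lemma weak_face_polyhedral d n A (F : nat -> bool) :
  exists P, cuts_weak_face d n A F P.
Proof.
  (* The level [M] is stored as coordinate [d] of the vector to be eliminated, with coefficient [-1]
     in [a k]; [e k] reads off the height of point [k]. *)
  set (e := fun k i : nat => if Nat.eqb i k then 1 else 0).
  set (a := fun k j : nat => if Nat.eqb j d then -1 else A k j).
  assert (Ha : forall k c, dot (S d) (a k) c = dot d c (A k) - c d).
  { intros k c. unfold dot, a. cbn. rewrite Nat.eqb_refl.
    rewrite (rsum_ext d _ (fun j => c j * A k j)); [ring|].
    intros j Hj. destruct (Nat.eqb_spec j d); [lia|ring]. }
  (* The reversed inequality for points of [F], and the trivial form for the others. The zero second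
     terms give it the shape that [dot_lincomb_l] evaluates. *)
  set (lo := fun k => if F k then ((fun i => (-1) * e k i + 0 * e k i),
                                   (fun i => (-1) * a k i + 0 * a k i))
                      else ((fun _ => 0), (fun _ => 0))).
  destruct (fourier_motzkin n (S d)
              (map (fun k => (e k, a k)) (seq 0 n) ++ map lo (seq 0 n))) as [P HP].
  exists P. intros y. rewrite <- HP. clear P HP. split.
  - intros [c [M H]]. exists (fun j => if Nat.eqb j d then M else c j).
    set (c' := fun j => if Nat.eqb j d then M else c j).
    assert (Hc : forall k, dot d c' (A k) = dot d c (A k)).
    { intros k. apply dot_ext; [|easy]. intros j Hj. unfold c'.
      destruct (Nat.eqb_spec j d); [lia|easy]. }
    assert (HM : c' d = M) by (unfold c'; now rewrite Nat.eqb_refl).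
    intros q Hq. apply in_app_or in Hq as [Hq|Hq];
      apply in_map_iff in Hq as [k [<- Hk]]; apply in_seq in Hk;
      destruct (H k) as [H1 H2]; try lia.
    + cbn [fst snd]. rewrite Ha, Hc, HM. unfold e.
      rewrite dot_indicator by lia. lra.
    + unfold lo. destruct (F k); cbn [fst snd].
      * rewrite !dot_lincomb_l, Ha, Hc, HM. unfold e.
        rewrite dot_indicator by lia. specialize (H2 eq_refl). lra.
      * rewrite !dot_0_l. lra.
  - intros [c H]. exists c, (c d). intros k Hk. split.
    + assert (Hq : In (e k, a k)
        (map (fun k => (e k, a k)) (seq 0 n) ++ map lo (seq 0 n))).
      { apply in_or_app. left. apply (in_map (fun k => (e k, a k))), in_seq. lia. }
      specialize (H _ Hq). cbn [fst snd] in H. rewrite Ha in H. unfold e in H.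
      rewrite dot_indicator in H by lia. lra.
    + intros HF. assert (Hq : In (lo k)
        (map (fun k => (e k, a k)) (seq 0 n) ++ map lo (seq 0 n))).
      { apply in_or_app. right. apply in_map, in_seq. lia. }
      specialize (H _ Hq). unfold lo in H. rewrite HF in H. cbn [fst snd] in H.
      rewrite !dot_lincomb_l, Ha in H. unfold e in H.
      rewrite dot_indicator in H by lia. lra.
Qed.

Lemma finitely_many_subsets n :
  exists L : list (nat -> bool), forall F : nat -> bool,
    exists G, In G L /\ forall k, (k < n)%nat -> G k = F k.
Proof.
  induction n as [|n [L HL]].
  - exists [fun _ => true]. intros F. exists (fun _ => true).
    split; [now left|lia].
  - set (f := fun (b : bool) (G : nat -> bool) k => if Nat.eqb k n then b else G k).
    exists (map (f true) L ++ map (f false) L). intros F.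
    destruct (HL F) as [G [HG E]]. exists (f (F n) G). split.
    + apply in_or_app. destruct (F n); [left|right]; now apply in_map.
    + intros k Hk. unfold f. destruct (Nat.eqb_spec k n) as [->|]; [easy|].
      apply E. lia.
Qed.

(** One finite list serves all [F] at once, so the subsequence and [lam] can be chosen before any
    particular face is considered. Finiteness holds because [F] matters only through its values
    below [n]. *)
Lemma weak_faces_polyhedral d n A :
  exists Q : list (nat -> R),
    forall F, exists P, incl P Q /\ cuts_weak_face d n A F P.
Proof.
  destruct (finitely_many_subsets n) as [L HL].
  assert (H : exists Q, forall F, In F L ->
    exists P, incl P Q /\ cuts_weak_face d n A F P).
  { clear HL. induction L as [|F L [Q HQ]].
    - exists []. intros F [].
    - destruct (weak_face_polyhedral d n A F) as [P HP].
      exists (P ++ Q). intros G [<-|HG].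
      + exists P. split; [now apply incl_appl, incl_refl|easy].
      + destruct (HQ G HG) as [P' [H1 H2]]. exists P'. split; [|easy].
        now apply incl_appr. }
  destruct H as [Q HQ]. exists Q. intros F.
  destruct (HL F) as [G [HG E]]. destruct (HQ G HG) as [P [H1 H2]].
  exists P. split; [easy|]. intros y. rewrite <- (H2 y).
  split; apply weak_face_ext; intros k Hk; [symmetry|]; auto.
Qed.

(** If [F] is a weak face for the heights [y + T * off F] with [T > 0], then the points outside [F]
    lie at least [T] below the hyperplane carrying [F]: [T] measures a gap. *)
Definition off (F : nat -> bool) (k : nat) : R := if F k then 0 else 1.

Definition affine_on (d n : nat) (A : nat -> nat -> R) (F : nat -> bool)
  (y : nat -> R) : Prop :=
  exists c M, forall k, (k < n)%nat -> F k = true -> dot d c (A k) + y k = M.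

Lemma affine_on_opp d n A F y :
  affine_on d n A F y -> affine_on d n A F (fun k => -1 * y k).
Proof.
  intros [c [M H]]. exists (fun j => -1 * c j), (- M). intros k Hk HF.
  rewrite dot_comm, dot_scal_r, dot_comm. specialize (H k Hk HF). lra.
Qed.

(** Lowering the points outside [F] below the zero lift leaves [F] on the horizontal hyperplane, so
    [- off F] belongs to the cone cut out by [P]. *)
Lemma dot_off_nonneg d n A F P p :
  cuts_weak_face d n A F P -> In p P -> 0 <= dot n p (off F).
Proof.
  intros HP Hp. assert (H : weak_face d n A F (fun k => -1 * off F k)).
  { exists (fun _ => 0), 0. intros k Hk. rewrite dot_0_l. unfold off.
    destruct (F k); split; try easy; lra. }
  apply (proj1 (HP _) H) in Hp. rewrite dot_scal_r in Hp. lra.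
Qed.

Lemma finite_upper_bound n (f : nat -> R) :
  exists T, forall k, (k < n)%nat -> f k <= T.
Proof.
  induction n as [|n [T HT]].
  - exists 0. lia.
  - exists (Rmax T (f n)). intros k Hk.
    destruct (Nat.eq_dec k n) as [->|]; [apply Rmax_r|].
    eapply Rle_trans; [apply HT; lia|apply Rmax_l].
Qed.

Lemma list_large_multiple {I : Type} (P : list I) (a b : I -> R) :
  (forall p, In p P -> 0 <= b p) -> (forall p, In p P -> b p = 0 -> a p <= 0) ->
  exists T, 0 < T /\ forall p, In p P -> a p <= T * b p.
Proof.
  induction P as [|q P IH]; intros H1 H2.
  - exists 1. split; [lra|]. intros p [].
  - destruct IH as [T [HT H]]; [simpl in *; auto..|].
    specialize (H1 q (or_introl eq_refl)) as Hq1.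
    specialize (H2 q (or_introl eq_refl)) as Hq2.
    exists (Rmax T (a q / b q)). split; [pose proof (Rmax_l T (a q / b q)); lra|].
    intros p [->|Hp].
    + destruct (Req_dec (b p) 0) as [E|E]; [rewrite E; specialize (Hq2 E); lra|].
      pose proof (Rmax_r T (a p / b p)).
      assert (a p = a p / b p * b p) by now field. nra.
    + pose proof (Rmax_l T (a q / b q)). specialize (H p Hp).
      assert (0 <= b p) by (apply H1; now right). nra.
Qed.

Lemma list_small_multiple {I : Type} (P : list I) (a b : I -> R) :
  (forall p, In p P -> 0 <= b p) ->
  (forall p, In p P -> a p <= 0) -> (forall p, In p P -> 0 < b p -> a p < 0) ->
  exists T, 0 < T /\ forall p, In p P -> a p + T * b p <= 0.
Proof.
  intros H1 H2 H3.
  (* The roles are exchanged: a bound [b p <= T * (- a p)], divided by [T], shows that [/ T] is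
     small enough. *)
  destruct (list_large_multiple P b (fun p => - a p)) as [T [HT H]].
  - intros p Hp. specialize (H2 p Hp). lra.
  - intros p Hp E. destruct (Rle_dec (b p) 0) as [|Hb]; [easy|].
    specialize (H3 p Hp). lra.
  - exists (/ T). split; [now apply Rinv_0_lt_compat|]. intros p Hp.
    specialize (H p Hp). apply (Rmult_le_reg_l T); [easy|].
    rewrite Rmult_plus_distr_l, <- Rmult_assoc, Rinv_r by lra. lra.
Qed.

(* The trace on F of affine functions is cut out by those forms of P that do
   not see the coordinates outside F: weight far below the face is free. *)
Lemma affine_on_polyhedral d n A F P (y : nat -> R) :
  cuts_weak_face d n A F P ->
  affine_on d n A F y <->
  (forall p, In p P -> dot n p (off F) = 0 -> dot n p y <= 0).
Proof.
  intros HP. split.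
  - intros [c [M H]] p Hp E.
    destruct (finite_upper_bound n (fun k => dot d c (A k) + y k - M)) as [T HT].
    assert (HW : weak_face d n A F (fun k => y k + - T * off F k)).
    { exists c, M. intros k Hk. specialize (H k Hk). specialize (HT k Hk).
      unfold off. destruct (F k); [specialize (H eq_refl)|];
      (split; [|intros; try easy]); lra. }
    apply (proj1 (HP _) HW) in Hp. rewrite dot_plus_r, dot_scal_r, E in Hp. lra.
  - intros H.
    destruct (list_large_multiple P (fun p => dot n p y) (fun p => dot n p (off F)))
      as [T [_ HT]].
    + intros p Hp. now apply (dot_off_nonneg d n A F P).
    + easy.
    + assert (HW : weak_face d n A F (fun k => y k + - T * off F k)).
      { apply HP. intros p Hp. rewrite dot_plus_r, dot_scal_r.
        specialize (HT p Hp). lra. }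
      destruct HW as [c [M HW]]. exists c, M. intros k Hk HF.
      specialize (HW k Hk). unfold off in HW. rewrite HF in HW.
      destruct HW as [H1 H2]. specialize (H2 eq_refl). lra.
Qed.

(** * Faces of the regular subdivision as weak faces with a gap *)

Lemma exists_argmax n (f : nat -> R) :
  (1 <= n)%nat -> exists k, (k < n)%nat /\ forall m, (m < n)%nat -> f m <= f k.
Proof.
  induction n as [|n IH]; intros Hn; [lia|].
  destruct n as [|n].
  - exists 0%nat. split; [lia|]. intros m Hm. replace m with 0%nat by lia. lra.
  - destruct IH as [k [Hk H]]; [lia|].
    destruct (Rle_dec (f k) (f (S n))) as [Hf|Hf].
    + exists (S n). split; [lia|]. intros m Hm.
      destruct (Nat.eq_dec m (S n)) as [->|]; [lra|].
      specialize (H m). assert (f m <= f k) by (apply H; lia). lra.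
    + exists k. split; [lia|]. intros m Hm.
      destruct (Nat.eq_dec m (S n)) as [->|]; [lra|]. apply H. lia.
Qed.

Lemma reg_face_nonempty d n A lam F :
  (1 <= n)%nat -> reg_face d n A lam F -> exists k, (k < n)%nat /\ F k = true.
Proof.
  intros Hn [c [_ H]]. destruct (exists_argmax n (lin_val d A lam c) Hn) as [k [Hk Hm]].
  exists k. split; [easy|]. now apply H.
Qed.

(** A face consists of all maximizers of a functional, so the finitely many other points lie
    strictly below the maximum and a common gap [T] exists. Conversely a positive gap excludes the
    points outside [F] from the maximizers, provided [F] is nonempty so that the level [M] is
    attained. *)
Lemma reg_face_iff_gap d n A lam F :
  (1 <= n)%nat ->
  reg_face d n A lam F <->
  (forall k, (k >= n)%nat -> F k = false) /\ (exists k, (k < n)%nat /\ F k = true) /\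
  exists T, 0 < T /\ weak_face d n A F (fun k => lam k + T * off F k).
Proof.
  intros Hn. split.
  - intros HF. pose proof (reg_face_nonempty _ _ _ _ _ Hn HF) as Hne.
    destruct HF as [c [H0 H]]. split; [easy|]. split; [easy|].
    destruct Hne as [k0 [Hk0 HF0]].
    set (M := lin_val d A lam c k0).
    destruct (list_small_multiple (seq 0 n) (fun k => lin_val d A lam c k - M) (off F))
      as [T [HT HM]].
    + intros k _. unfold off. destruct (F k); lra.
    + intros k Hk. apply in_seq in Hk.
      assert (lin_val d A lam c k <= M) by (apply H; [easy|easy|lia]). lra.
    + intros k Hk Hoff. apply in_seq in Hk.
      assert (Hle : lin_val d A lam c k <= M) by (apply H; [easy|easy|lia]).
      (* A point outside [F] at level [M] would be a maximizer and hence belong to [F]. *)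
      destruct (Rle_lt_dec M (lin_val d A lam c k)) as [Hge|]; [|lra].
      exfalso. assert (HFk : F k = true).
      { apply H; [lia|]. intros m Hm. apply Rle_trans with M; [|easy].
        now apply H. }
      unfold off in Hoff. rewrite HFk in Hoff. lra.
    + exists T. split; [easy|]. exists c, M. intros k Hk.
      assert (HMk : lin_val d A lam c k - M + T * off F k <= 0)
        by (apply HM, in_seq; lia).
      unfold lin_val in HMk. fold (dot d c (A k)) in HMk. split; [lra|].
      intros HFk. unfold off. rewrite HFk.
      assert (M <= lin_val d A lam c k) by now apply H.
      unfold lin_val in H1. fold (dot d c (A k)) in H1. lra.
  - intros [H0 [[k0 [Hk0 HF0]] [T [HT [c [M H]]]]]].
    exists c. split; [easy|]. intros k Hk.
    assert (HM : forall m, (m < n)%nat -> lin_val d A lam c m <= M - T * off F m).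
    { intros m Hm. destruct (H m Hm) as [H1 _]. unfold lin_val.
      fold (dot d c (A m)). lra. }
    assert (HF : forall m, (m < n)%nat -> F m = true -> lin_val d A lam c m = M).
    { intros m Hm HFm. destruct (H m Hm) as [H1 H2]. specialize (H2 HFm).
      unfold off in H1, H2. rewrite HFm in H1, H2. unfold lin_val.
      fold (dot d c (A m)). lra. }
    split.
    + intros HFk m Hm. rewrite (HF k Hk HFk). specialize (HM m Hm).
      assert (0 <= off F m) by (unfold off; destruct (F m); lra). nra.
    + intros Hmax. specialize (Hmax k0 Hk0). rewrite (HF k0 Hk0 HF0) in Hmax.
      specialize (HM k Hk). unfold off in HM. destruct (F k); [easy|lra].
Qed.

(** * Extracting subsequences *)

Definition extraction (phi : nat -> nat) : Prop :=
  forall j, (phi j < phi (S j))%nat.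

Lemma extraction_comp phi psi :
  extraction phi -> extraction psi -> extraction (fun j => phi (psi j)).
Proof.
  intros Hphi Hpsi j. specialize (Hpsi j).
  induction Hpsi as [|m _ IH]; [apply Hphi|].
  eapply Nat.lt_trans; [exact IH|apply Hphi].
Qed.

Lemma extraction_ge_id phi j : extraction phi -> (j <= phi j)%nat.
Proof. intros H. induction j as [|j IH]; [lia|]. specialize (H j). lia. Qed.

Lemma extract_subsequence (P : nat -> nat -> Prop) :
  (forall i N, exists m, (N <= m)%nat /\ P i m) ->
  exists phi, extraction phi /\ forall i, P i (phi i).
Proof.
  intros H.
  destruct (functional_choice (fun (iN : nat * nat) m => (snd iN <= m)%nat /\ P (fst iN) m))
    as [f Hf]; [intros [i N]; apply H|].
  (* Asking for an index at least [S (phi i')] makes [phi] strictly increasing. *)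
  set (phi := fix phi i := match i with
                | O => f (O, O) | S i' => f (S i', S (phi i')) end).
  exists phi. split.
  - intros j. exact (proj1 (Hf (S j, S (phi j)))).
  - intros [|i]; simpl; [exact (proj2 (Hf (O, O)))|].
    exact (proj2 (Hf (S i, S (phi i)))).
Qed.

Lemma is_lim_seq_extraction u (l : Rbar) phi :
  extraction phi -> is_lim_seq u l -> is_lim_seq (fun j => u (phi j)) l.
Proof. intros H. apply is_lim_seq_subseq, eventually_subseq, H. Qed.

Lemma is_lim_seq_of_harmonic_bound (u : nat -> R) (l : R) :
  (forall i, Rabs (u i - l) < / (INR i + 1)) -> is_lim_seq u l.
Proof.
  intros H. apply is_lim_seq_spec. intros eps.
  pose proof is_lim_seq_INR as HI. apply is_lim_seq_spec in HI.
  destruct (HI (/ eps)) as [N HN]. exists N. intros i Hi.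
  eapply Rlt_trans; [apply H|]. specialize (HN i Hi).
  rewrite <- (Rinv_inv eps). pose proof (cond_pos eps) as He.
  apply Rinv_0_lt_compat in He. apply Rinv_lt_contravar; [|lra]. nra.
Qed.

Lemma inv_INR_succ_pos i : 0 < / (INR i + 1).
Proof. apply Rinv_0_lt_compat. pose proof (pos_INR i). lra. Qed.

(** The subsequence tends to the upper limit: a finite one is approached infinitely often, [p_infty]
    lets the terms outgrow [INR], and [m_infty] is already the limit of the whole sequence. *)
Lemma exists_Rbar_convergent_subsequence (u : nat -> R) :
  exists phi (l : Rbar), extraction phi /\ is_lim_seq (fun j => u (phi j)) l.
Proof.
  destruct (ex_LimSup_seq u) as [l Hl]. destruct l as [l| |]; simpl in Hl.
  - destruct (extract_subsequence (fun i m => Rabs (u m - l) < / (INR i + 1)))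
      as [phi [Hphi H]].
    + intros i N. destruct (Hl (mkposreal _ (inv_INR_succ_pos i))) as [H1 [N0 H2]]. simpl in *.
      destruct (H1 (N + N0)%nat) as [m [Hm Hu]]. exists m. split; [lia|].
      specialize (H2 m ltac:(lia)). apply Rabs_def1; lra.
    + exists phi, l. split; [easy|]. now apply is_lim_seq_of_harmonic_bound.
  - destruct (extract_subsequence (fun i m => INR i < u m)) as [phi [Hphi H]].
    + intros i N. apply Hl.
    + exists phi, p_infty. split; [easy|].
      apply is_lim_seq_le_p_loc with INR; [|apply is_lim_seq_INR].
      exists O. intros i _. now apply Rlt_le.
  - exists (fun j => j), m_infty. split; [intros j; lia|].
    apply is_lim_seq_spec. exact Hl.
Qed.

Lemma exists_jointly_convergent_subsequence {I : Type} (Q : list I)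
  (u : I -> nat -> R) :
  exists phi, extraction phi /\
    forall q, In q Q -> exists l : Rbar, is_lim_seq (fun j => u q (phi j)) l.
Proof.
  induction Q as [|q Q [phi [Hphi H]]].
  - exists (fun j => j). split; [intros j; lia|]. intros q [].
  - destruct (exists_Rbar_convergent_subsequence (fun j => u q (phi j)))
      as [psi [l [Hpsi Hl]]].
    exists (fun j => phi (psi j)). split; [now apply extraction_comp|].
    intros p [<-|Hp]; [now exists l|].
    destruct (H p Hp) as [l' Hl']. exists l'.
    now apply (is_lim_seq_extraction (fun j => u p (phi j))).
Qed.

Lemma eventually_forall_list {I : Type} (Q : list I) (P : I -> nat -> Prop) :
  (forall q, In q Q -> eventually (P q)) ->
  eventually (fun j => forall q, In q Q -> P q j).
Proof.
  induction Q as [|q Q IH]; intros H.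
  - exists O. intros j _ p [].
  - destruct IH as [N1 H1]; [intros; apply H; now right|].
    destruct (H q (or_introl eq_refl)) as [N2 H2].
    exists (N1 + N2)%nat. intros j Hj p [<-|Hp]; [apply H2|apply H1]; auto; lia.
Qed.

Lemma eventually_forall_lt n (P : nat -> nat -> Prop) :
  (forall k, (k < n)%nat -> eventually (P k)) ->
  eventually (fun j => forall k, (k < n)%nat -> P k j).
Proof.
  intros H. destruct (eventually_forall_list (seq 0 n) P) as [N HN].
  - intros k Hk. apply in_seq in Hk. apply H. lia.
  - exists N. intros j Hj k Hk. apply HN; [easy|]. apply in_seq. lia.
Qed.

(** * Tropical limits of sequences of weights *)

(** Gaussian elimination: prescribed convergent values of finitely many forms, attained by some
    sequence, are also attained by a convergent one, because a solution can be computed linearly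
    from these values. *)
Lemma convergent_lift n (B : list (nat -> R)) (v : nat -> nat -> R) :
  (forall p, In p B -> ex_finite_lim_seq (fun j => dot n p (v j))) ->
  exists (corr : nat -> nat -> R) (w : nat -> R),
    (forall k, (k < n)%nat -> is_lim_seq (fun j => corr j k) (w k)) /\
    (forall p, In p B -> forall j, dot n p (corr j) = dot n p (v j)).
Proof.
  revert B. induction n as [|n IH]; intros B H.
  - exists (fun _ _ => 0), (fun _ => 0). split; [lia|]. easy.
  - set (ext := fun (y : nat -> R) (t : R) k => if Nat.eqb k n then t else y k).
    assert (Hext : forall p y t, dot (S n) p (ext y t) = dot n p y + p n * t).
    { intros p y t. unfold dot, ext. cbn. rewrite Nat.eqb_refl.
      rewrite (rsum_ext n _ (fun k => p k * y k)); [easy|].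
      intros k Hk. destruct (Nat.eqb_spec k n); [lia|easy]. }
    assert (Hlim : forall (u : nat -> nat -> R) s (l : nat -> R) (t : R),
      (forall k, (k < n)%nat -> is_lim_seq (fun j => u j k) (l k)) ->
      is_lim_seq s t ->
      forall k, (k < S n)%nat -> is_lim_seq (fun j => ext (u j) (s j) k) (ext l t k)).
    { intros u s l t Hu Hs k Hk. unfold ext. destruct (Nat.eqb_spec k n); [easy|].
      apply Hu. lia. }
    destruct (classic (exists p0, In p0 B /\ p0 n <> 0)) as [[p0 [Hp0 Hn]]|Hno].
    (* With [p0] as pivot, [red p] has last coefficient zero. The reduced forms are handled by
       induction, and the equation for [p0] then determines the last coordinate [s j]. *)
    + set (red := fun (p : nat -> R) k => 1 * p k + - (p n / p0 n) * p0 k).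
      assert (Hred : forall p y, dot (S n) (red p) y = dot n (red p) y).
      { intros p y. unfold dot. cbn. unfold red at 2. field. easy. }
      destruct (IH (map red B)) as [corr [w [H1 H2]]].
      { intros q Hq. apply in_map_iff in Hq as [p [<- Hp]].
        destruct (H p Hp) as [l Hl]. destruct (H p0 Hp0) as [l0 Hl0].
        exists (1 * l + - (p n / p0 n) * l0).
        apply is_lim_seq_ext with
          (fun j => 1 * dot (S n) p (v j) + - (p n / p0 n) * dot (S n) p0 (v j)).
        { intros j. rewrite <- Hred. unfold red. now rewrite dot_lincomb_l. }
        apply is_lim_seq_plus'.
        - now apply (is_lim_seq_scal_l _ 1 l).
        - now apply (is_lim_seq_scal_l _ (- (p n / p0 n)) l0). }
      destruct (H p0 Hp0) as [l0 Hl0].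
      set (s := fun j => (dot (S n) p0 (v j) - dot n p0 (corr j)) / p0 n).
      exists (fun j => ext (corr j) (s j)), (ext w ((l0 - dot n p0 w) / p0 n)).
      split.
      * apply Hlim; [easy|]. apply is_lim_seq_div'; [|apply is_lim_seq_const|easy].
        apply is_lim_seq_minus'; [easy|]. now apply is_lim_seq_dot.
      * assert (H0 : forall j, dot (S n) p0 (ext (corr j) (s j)) = dot (S n) p0 (v j)).
        { intros j. rewrite Hext. unfold s. field. easy. }
        intros p Hp j. specialize (H2 (red p) (in_map red _ _ Hp) j).
        rewrite <- !Hred in H2.
        assert (E : dot (S n) (red p) (ext (corr j) (s j)) = dot (S n) (red p) (v j)).
        { rewrite <- H2, Hext, Hred. unfold red at 2. field. easy. }
        unfold red in E. rewrite !dot_lincomb_l, H0 in E. lra.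
    (* No form of [B] sees the last coordinate, so it may be set to 0. *)
    + destruct (IH B) as [corr [w [H1 H2]]].
      { intros p Hp. destruct (H p Hp) as [l Hl]. exists l.
        apply is_lim_seq_ext with (2 := Hl). intros j. unfold dot. cbn.
        replace (p n) with 0; [ring|]. symmetry. apply NNPP. intros E. apply Hno. eauto. }
      exists (fun j => ext (corr j) 0), (ext w 0). split.
      * apply Hlim; [easy|apply is_lim_seq_const].
      * intros p Hp j. rewrite Hext, H2 by easy. unfold dot. cbn.
        replace (p n) with 0; [ring|]. symmetry. apply NNPP. intros E. apply Hno. eauto.
Qed.

(* On each form of Q, v_j - corr_j either vanishes or diverges with the sign of lam. *)
Definition tropical_limit (n : nat) (Q : list (nat -> R)) (v : nat -> nat -> R)
  (lam : nat -> R) (corr : nat -> nat -> R) (w : nat -> R) : Prop :=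
  (forall k, (k < n)%nat -> is_lim_seq (fun j => corr j k) (w k)) /\
  forall p, In p Q -> exists l : Rbar,
    is_lim_seq (fun j => dot n p (v j)) l /\
    match l with
    | Finite _ => dot n p lam = 0 /\ forall j, dot n p (corr j) = dot n p (v j)
    | p_infty => 0 < dot n p lam
    | m_infty => dot n p lam < 0
    end.

(** Since [corr] converges, subtracting it does not affect infinite limits. Hence each form of [Q]
    has the required sign on [v - corr] from some index on, and finiteness of [Q] gives an index [J]
    that suits all of them. *)
Lemma exists_tropical_limit n (Q : list (nat -> R)) (v : nat -> nat -> R) :
  exists phi lam corr w,
    extraction phi /\ tropical_limit n Q (fun j => v (phi j)) lam corr w.
Proof.
  destruct (exists_jointly_convergent_subsequence Q (fun p j => dot n p (v j)))
    as [phi [Hphi H]].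
  (* [B] collects the forms with a finite limit; these are the ones that [corr] must reproduce
     exactly. *)
  assert (HB : exists B, forall p, In p B <->
            In p Q /\ ex_finite_lim_seq (fun j => dot n p (v (phi j)))).
  { clear H. induction Q as [|q Q [B HB]]; [now exists []|].
    destruct (classic (ex_finite_lim_seq (fun j => dot n q (v (phi j))))) as [Hq|Hq].
    - exists (q :: B). intros p. simpl. rewrite HB. split; [|tauto].
      intros [<-|Hp]; tauto.
    - exists B. intros p. simpl. rewrite HB. split; [tauto|].
      intros [[<-|Hp] Hl]; tauto. }
  destruct HB as [B HB].
  destruct (convergent_lift n B (fun j => v (phi j))) as [corr [w [H1 H2]]].
  { intros p Hp. now apply HB. }
  assert (Hdiff : forall p j, dot n p (fun k => v (phi j) k + -1 * corr j k) =
            dot n p (v (phi j)) + -1 * dot n p (corr j)).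
  { intros. now rewrite dot_plus_r, dot_scal_r. }
  set (good := fun p (l : Rbar) j => match l with
      | Finite _ => dot n p (fun k => v (phi j) k + -1 * corr j k) = 0 /\
                    forall i, dot n p (corr i) = dot n p (v (phi i))
      | p_infty => 0 < dot n p (fun k => v (phi j) k + -1 * corr j k)
      | m_infty => dot n p (fun k => v (phi j) k + -1 * corr j k) < 0 end).
  destruct (eventually_forall_list Q (fun p j => exists l : Rbar,
      is_lim_seq (fun j => dot n p (v (phi j))) l /\ good p l j)) as [J HJ].
  { intros p Hp. destruct (H p Hp) as [l Hl].
    pose proof (is_lim_seq_dot n p corr w H1) as Hc.
    apply (is_lim_seq_scal_l _ (-1)) in Hc. destruct l as [l| |].
    - assert (HpB : In p B) by (apply HB; split; [easy|now exists l]).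
      exists O. intros j _. exists l. split; [easy|]. split.
      + rewrite Hdiff, H2 by easy. ring.
      + auto.
    - assert (Hs : is_lim_seq (fun j => dot n p (v (phi j)) + -1 * dot n p (corr j)) p_infty)
        by (eapply is_lim_seq_plus; [exact Hl|exact Hc|easy]).
      apply is_lim_seq_spec in Hs. destruct (Hs 0) as [N HN].
      exists N. intros j Hj. exists p_infty. split; [easy|].
      unfold good. rewrite Hdiff. auto.
    - assert (Hs : is_lim_seq (fun j => dot n p (v (phi j)) + -1 * dot n p (corr j)) m_infty)
        by (eapply is_lim_seq_plus; [exact Hl|exact Hc|easy]).
      apply is_lim_seq_spec in Hs. destruct (Hs 0) as [N HN].
      exists N. intros j Hj. exists m_infty. split; [easy|].
      unfold good. rewrite Hdiff. auto. }
  exists phi, (fun k => v (phi J) k + -1 * corr J k), corr, w.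
  split; [easy|]. split; [easy|]. intros p Hp.
  exact (HJ J (le_n J) p Hp).
Qed.

(** * Normalised vectors and the l1 distance *)

(** The representative in the simplex of a point given by homogeneous coordinates; both [param] and
    [act] have this shape. *)
Definition nrm (n : nat) (h : nat -> R) (k : nat) : R := h k / rsum n h.

Lemma nrm_scal n (h : nat -> R) (t : R) k :
  t <> 0 -> rsum n h <> 0 -> nrm n (fun i => t * h i) k = nrm n h k.
Proof. intros Ht Hh. unfold nrm. rewrite rsum_scal. field. auto. Qed.

Lemma nrm_ext n (g h : nat -> R) k :
  (k < n)%nat -> (forall i, (i < n)%nat -> g i = h i) -> nrm n g k = nrm n h k.
Proof. intros Hk H. unfold nrm. now rewrite (rsum_ext n g h), H. Qed.

Lemma l1dist_ext n (y y' z z' : nat -> R) :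
  (forall k, (k < n)%nat -> y k = y' k) -> (forall k, (k < n)%nat -> z k = z' k) ->
  l1dist n y z = l1dist n y' z'.
Proof. intros H1 H2. apply rsum_ext. intros k Hk. now rewrite H1, H2. Qed.

Lemma l1dist_refl n (y : nat -> R) : l1dist n y y = 0.
Proof.
  unfold l1dist. transitivity (rsum n (fun _ => 0)); [|apply rsum_0].
  apply rsum_ext. intros k _. rewrite Rminus_diag. apply Rabs_R0.
Qed.

Lemma l1dist_sym n (y z : nat -> R) : l1dist n y z = l1dist n z y.
Proof. apply rsum_ext. intros. apply Rabs_minus_sym. Qed.

Lemma l1dist_triangle n (x y z : nat -> R) :
  l1dist n x z <= l1dist n x y + l1dist n y z.
Proof.
  unfold l1dist. rewrite <- rsum_plus. apply rsum_le. intros k _.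
  replace (x k - z k) with ((x k - y k) + (y k - z k)) by ring. apply Rabs_triang.
Qed.

Lemma coord_le_l1dist n (y z : nat -> R) k :
  (k < n)%nat -> Rabs (y k - z k) <= l1dist n y z.
Proof.
  intros Hk. apply (rsum_ge_term n (fun i => Rabs (y i - z i))); [|easy].
  intros. apply Rabs_pos.
Qed.

Lemma is_lim_seq_finite_eps (u : nat -> R) (l eps : R) :
  is_lim_seq u l -> 0 < eps -> eventually (fun j => Rabs (u j - l) < eps).
Proof.
  intros H He. apply is_lim_seq_spec in H. exact (H (mkposreal eps He)).
Qed.

Lemma eventually_l1dist_lt n (u : nat -> nat -> R) (l : nat -> R) (eps : R) :
  (forall k, (k < n)%nat -> is_lim_seq (fun j => u j k) (l k)) -> 0 < eps ->
  eventually (fun j => l1dist n (u j) l < eps).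
Proof.
  intros H He.
  assert (HL : is_lim_seq (fun j => l1dist n (u j) l) 0).
  { rewrite <- (l1dist_refl n l). unfold l1dist at 2.
    apply (is_lim_seq_rsum n (fun j k => Rabs (u j k - l k))). intros k Hk.
    apply (is_lim_seq_abs _ (Finite (l k - l k))).
    apply is_lim_seq_minus'; [auto|apply is_lim_seq_const]. }
  destruct (is_lim_seq_finite_eps _ _ _ HL He) as [N HN]. exists N.
  intros j Hj. specialize (HN j Hj). rewrite Rminus_0_r in HN.
  eapply Rle_lt_trans; [apply Rle_abs|exact HN].
Qed.

Lemma is_lim_seq_nrm n (u : nat -> nat -> R) (l : nat -> R) :
  (forall k, (k < n)%nat -> is_lim_seq (fun j => u j k) (l k)) -> rsum n l <> 0 ->
  forall k, (k < n)%nat -> is_lim_seq (fun j => nrm n (u j) k) (nrm n l k).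
Proof.
  intros H H0 k Hk. apply is_lim_seq_div'; auto. now apply is_lim_seq_rsum.
Qed.

(** * Points of the toric varieties *)

(** Logarithmic form of the translated monomials: with [c = log x] and [v = log u], this is
    [u_a x^a] before normalisation. *)
Definition weights (d : nat) (A : nat -> nat -> R) (c v : nat -> R) (k : nat) : R :=
  exp (dot d c (A k) + v k).

Lemma param_nrm d n A F w x k :
  param d n A F w x k =
  nrm n (fun i => if F i then w i * mono d (A i) x else 0) k.
Proof. unfold param, nrm. destruct (F k); [easy|]. unfold Rdiv. ring. Qed.

Lemma mono_dot d a x : mono d a x = exp (dot d (fun j => ln (x j)) a).
Proof. unfold mono. f_equal. apply rsum_ext. intros; ring. Qed.

Lemma mono_exp d a c : mono d a (fun j => exp (c j)) = exp (dot d c a).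
Proof.
  rewrite mono_dot. f_equal. apply dot_ext; [|easy]. intros. apply ln_exp.
Qed.

Lemma weighted_sum_pos d n A F w x :
  (forall k, (k < n)%nat -> 0 < w k) -> (exists k, (k < n)%nat /\ F k = true) ->
  0 < rsum n (fun i => if F i then w i * mono d (A i) x else 0).
Proof.
  intros Hw [k [Hk HF]].
  apply Rlt_le_trans with (if F k then w k * mono d (A k) x else 0).
  - rewrite HF. apply Rmult_lt_0_compat; [auto|apply exp_pos].
  - apply (rsum_ge_term n (fun i => if F i then w i * mono d (A i) x else 0)); [|easy].
    intros i Hi. destruct (F i); [|lra]. apply Rmult_le_pos.
    + now apply Rlt_le, Hw.
    + apply Rlt_le, exp_pos.
Qed.

Lemma weights_sum_pos d n A c v : (1 <= n)%nat -> 0 < rsum n (weights d A c v).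
Proof.
  intros Hn. apply Rlt_le_trans with (weights d A c v 0); [apply exp_pos|].
  apply rsum_ge_term; [|lia]. intros. apply Rlt_le, exp_pos.
Qed.

Lemma param_in_X_Fw d n A F w x :
  (forall k, (k < n)%nat -> 0 < w k) -> (exists k, (k < n)%nat /\ F k = true) ->
  pos_vec d x -> X_Fw d n A F w (param d n A F w x).
Proof.
  intros Hw Hne Hx. pose proof (weighted_sum_pos d n A F w x Hw Hne) as Hs.
  split; [split; [split|]|].
  - intros k Hk. rewrite param_nrm. apply Rdiv_le_0_compat; [|easy].
    destruct (F k); [|lra]. apply Rmult_le_pos; [now apply Rlt_le, Hw|apply Rlt_le, exp_pos].
  - rewrite (rsum_ext n _ (fun k => / rsum n (fun i => if F i then w i * mono d (A i) x else 0)
      * (if F k then w k * mono d (A k) x else 0))).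
    + rewrite rsum_scal. field. lra.
    + intros k _. rewrite param_nrm. unfold nrm. field. lra.
  - intros k _ HF. unfold param. now rewrite HF.
  - intros eps He. exists (param d n A F w x). split; [now exists x|].
    now rewrite l1dist_refl.
Qed.

Lemma act_param d n A u c k :
  (forall i, (i < n)%nat -> 0 < u i) -> (k < n)%nat ->
  act n u (param d n A (fun _ => true) (fun _ => 1) (fun j => exp (c j))) k =
  nrm n (weights d A c (fun i => ln (u i))) k.
Proof.
  intros Hu Hk.
  set (s := rsum n (fun i => 1 * mono d (A i) (fun j => exp (c j)))).
  assert (Hs : 0 < s).
  { unfold s. apply (weighted_sum_pos d n A (fun _ => true) (fun _ => 1)).
    - intros; lra.
    - exists k. auto. }
  assert (Hn : (1 <= n)%nat) by lia.
  pose proof (weights_sum_pos d n A c (fun i => ln (u i)) Hn) as Hw.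
  rewrite <- (nrm_scal n _ (/ s)); [|apply Rinv_neq_0_compat; lra|lra].
  change (act n u ?z k) with (nrm n (fun i => u i * z i) k).
  apply nrm_ext; [easy|]. intros i Hi. unfold param. fold s.
  rewrite mono_exp. unfold weights. rewrite exp_plus, exp_ln by auto. field. lra.
Qed.

Lemma weights_in_act_set d n A u c :
  (1 <= n)%nat -> (forall i, (i < n)%nat -> 0 < u i) ->
  act_set n u (X_A d n A) (nrm n (weights d A c (fun i => ln (u i)))).
Proof.
  intros Hn Hu.
  exists (param d n A (fun _ => true) (fun _ => 1) (fun j => exp (c j))). split.
  - apply param_in_X_Fw.
    + intros; lra.
    + exists O. auto.
    + intros j _. apply exp_pos.
  - intros k Hk. now rewrite act_param.
Qed.

(** [X_A] is a closure, so its points are limits of monomial points; the action of [u] is continuous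
    at points of the simplex, where its denominator does not vanish. *)
Lemma act_set_approx d n A u y eps :
  (1 <= n)%nat -> (forall i, (i < n)%nat -> 0 < u i) ->
  act_set n u (X_A d n A) y -> 0 < eps ->
  exists c, l1dist n y (nrm n (weights d A c (fun i => ln (u i)))) < eps.
Proof.
  intros Hn Hu [z [[[[Hz Hz1] _] Hcl] Hy]] He.
  destruct (functional_choice (fun i x => pos_vec d x /\
      l1dist n z (param d n A (fun _ => true) (fun _ => 1) x) < / (INR i + 1)))
    as [x Hx].
  { intros i. destruct (Hcl _ (inv_INR_succ_pos i)) as [p [[x [Hx ->]] Hp]]. now exists x. }
  assert (Hlim : forall k, (k < n)%nat -> is_lim_seq
     (fun i => u k * param d n A (fun _ => true) (fun _ => 1) (x i) k) (u k * z k)).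
  { intros k Hk. apply (is_lim_seq_scal_l _ (u k) (z k)).
    apply is_lim_seq_of_harmonic_bound. intros i. rewrite Rabs_minus_sym.
    eapply Rle_lt_trans; [exact (coord_le_l1dist n z _ k Hk)|apply Hx]. }
  assert (Hpos : rsum n (fun k => u k * z k) <> 0).
  { intros E. assert (Hz0 : forall k, (k < n)%nat -> z k = 0).
    { intros k Hk. specialize (Hu k Hk) as Huk. specialize (Hz k Hk) as Hzk.
      assert (u k * z k <= 0).
      { rewrite <- E. apply (rsum_ge_term n (fun k => u k * z k)); [|easy].
        intros i Hi. apply Rmult_le_pos; [now apply Rlt_le, Hu|auto]. }
      nra. }
    rewrite (rsum_ext n z (fun _ => 0) Hz0), rsum_0 in Hz1. lra. }
  pose proof (is_lim_seq_nrm n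
    (fun i k => u k * param d n A (fun _ => true) (fun _ => 1) (x i) k)
    (fun k => u k * z k) Hlim Hpos) as HL.
  destruct (eventually_l1dist_lt n _ _ eps HL He) as [N HN].
  specialize (HN N (le_n N)). exists (fun j => ln (x N j)).
  rewrite l1dist_sym. eapply Rle_lt_trans; [|exact HN]. right.
  apply l1dist_ext.
  - intros k Hk. rewrite <- act_param by easy.
    change (act n u ?z k) with (nrm n (fun i => u i * z i) k).
    apply nrm_ext; [easy|]. intros i Hi. f_equal. rewrite !param_nrm.
    apply nrm_ext; [easy|]. intros m Hm. f_equal. now rewrite mono_exp, mono_dot.
  - intros k Hk. now rewrite Hy.
Qed.

(** * The limit complex *)

Lemma is_lim_seq_exp_m_infty (u : nat -> R) :
  is_lim_seq u m_infty -> is_lim_seq (fun j => exp (u j)) 0.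
Proof.
  intros H. exact (filterlim_comp _ _ _ u exp _ _ _ H is_lim_exp_m).
Qed.

Lemma is_lim_seq_exp (u : nat -> R) (l : R) :
  is_lim_seq u l -> is_lim_seq (fun j => exp (u j)) (exp l).
Proof.
  apply is_lim_seq_continuous, derivable_continuous_pt, derivable_pt_exp.
Qed.

Lemma not_eventually (P : nat -> Prop) :
  ~ eventually P -> forall N, exists m, (N <= m)%nat /\ ~ P m.
Proof.
  intros H N. apply NNPP. intros HN. apply H. exists N. intros m Hm.
  apply NNPP. intros HP. apply HN. now exists m.
Qed.

(** For [p] in [P], the gap of [lam] gives [p(lam) + T0 * p(off F) <= 0]. This excludes the limit
    [p_infty]. A finite limit has [p(lam) = 0], which forces [p(off F) = 0], and [p] vanishes on
    [v - corr]; with limit [m_infty] the term [T * p(off F)] is eventually absorbed. *)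
Lemma eventually_wide_gap d n A Q v lam corr w0 F P T :
  (1 <= n)%nat -> tropical_limit n Q v lam corr w0 ->
  incl P Q -> cuts_weak_face d n A F P -> reg_face d n A lam F ->
  eventually (fun j =>
    weak_face d n A F (fun k => (v j k + -1 * corr j k) + T * off F k)).
Proof.
  intros Hn [Hcorr Htrop] HPQ HP HF.
  apply reg_face_iff_gap in HF as [_ [_ [T0 [HT0 HW]]]]; [|easy].
  destruct (eventually_forall_list P (fun p j =>
      dot n p (fun k => (v j k + -1 * corr j k) + T * off F k) <= 0)) as [N HN].
  - intros p Hp. pose proof (dot_off_nonneg d n A F P p HP Hp) as Hb.
    pose proof (proj1 (HP _) HW p Hp) as Hlam. rewrite dot_plus_r, dot_scal_r in Hlam.
    destruct (Htrop p (HPQ p Hp)) as [l [Hl Hsgn]]. destruct l as [l| |].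
    + destruct Hsgn as [Hlam0 Hc]. exists O. intros j _.
      rewrite !dot_plus_r, !dot_scal_r, Hc.
      assert (dot n p (off F) = 0) as -> by nra. lra.
    + exfalso. nra.
    + assert (Hs : is_lim_seq (fun j => dot n p (v j) +
          (-1 * dot n p (corr j) + T * dot n p (off F))) m_infty).
      { apply is_lim_seq_plus with (l1 := m_infty)
          (l2 := -1 * dot n p w0 + T * dot n p (off F)); [easy| |easy].
        apply is_lim_seq_plus'; [|apply is_lim_seq_const].
        apply (is_lim_seq_scal_l _ (-1) (dot n p w0)). now apply is_lim_seq_dot. }
      apply is_lim_seq_spec in Hs. destruct (Hs 0) as [N HN].
      exists N. intros j Hj. rewrite !dot_plus_r, !dot_scal_r.
      specialize (HN j Hj). lra.
  - exists N. intros j Hj. apply HP. exact (HN j Hj).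
Qed.

(** The approximating [c] is the slope of a hyperplane supporting [v - corr] along [F] with a large
    gap, shifted by [log x]. On [F] the normalised weights then tend to [w_a x^a], and the widening
    gap sends the others to 0. The threshold depends on [x]; uniformity is obtained later from
    compactness. *)
Lemma face_points_approximated d n A Q v lam corr w0 F P x eps :
  (1 <= n)%nat -> tropical_limit n Q v lam corr w0 ->
  incl P Q -> cuts_weak_face d n A F P -> reg_face d n A lam F -> 0 < eps ->
  eventually (fun j => exists c,
    l1dist n (param d n A F (fun k => exp (w0 k)) x) (nrm n (weights d A c (v j))) < eps).
Proof.
  intros Hn Htrop HPQ HP HF He. apply NNPP. intros Hnot.
  pose proof (not_eventually _ Hnot) as Hinf.
  destruct (extract_subsequence (fun i m =>
    weak_face d n A F (fun k => (v m k + -1 * corr m k) + INR i * off F k) /\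
    ~ (exists c, l1dist n (param d n A F (fun k => exp (w0 k)) x)
                   (nrm n (weights d A c (v m))) < eps))) as [psi [Hpsi H]].
  { intros i N.
    destruct (eventually_wide_gap d n A Q v lam corr w0 F P (INR i)) as [N' HN']; auto.
    destruct (Hinf (N + N')%nat) as [m [Hm Hfail]]. exists m.
    split; [lia|]. split; [apply HN'; lia|easy]. }
  destruct (functional_choice (fun i (cM : (nat -> R) * R) => forall k, (k < n)%nat ->
     dot d (fst cM) (A k) + ((v (psi i) k + -1 * corr (psi i) k) + INR i * off F k) <= snd cM /\
     (F k = true -> snd cM <= dot d (fst cM) (A k) +
        ((v (psi i) k + -1 * corr (psi i) k) + INR i * off F k)))) as [cM HcM].
  { intros i. destruct (proj1 (H i)) as [c [M HM]]. now exists (c, M). }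
  set (lx := fun j => ln (x j)).
  set (c := fun i j => fst (cM i) j + lx j).
  (* Subtracting the level from the exponent only rescales the weights, so [nrm] is unchanged while
     the individual exponentials become convergent. *)
  set (r := fun i k => dot d (c i) (A k) + v (psi i) k - snd (cM i)).
  assert (Hc : forall i k, dot d (c i) (A k) = dot d (fst (cM i)) (A k) + dot d lx (A k)).
  { intros i k. rewrite dot_comm. unfold c.
    rewrite dot_plus_r, (dot_comm d (A k) lx), (dot_comm d (A k)). easy. }
  assert (Hcorr : forall k, (k < n)%nat ->
     is_lim_seq (fun i => corr (psi i) k + dot d lx (A k)) (w0 k + dot d lx (A k))).
  { intros k Hk. apply is_lim_seq_plus'; [|apply is_lim_seq_const].
    apply (is_lim_seq_extraction (fun j => corr j k)); [easy|]. now apply Htrop. }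
  set (g := fun k => if F k then exp (w0 k) * mono d (A k) x else 0).
  assert (Hlim : forall k, (k < n)%nat -> is_lim_seq (fun i => exp (r i k)) (g k)).
  { intros k Hk. unfold g. destruct (F k) eqn:HFk.
    - rewrite mono_dot, <- exp_plus.
      apply is_lim_seq_ext with (fun i => exp (corr (psi i) k + dot d lx (A k))).
      + intros i. f_equal. unfold r. rewrite Hc.
        destruct (HcM i k Hk) as [H1 H2]. specialize (H2 HFk).
        unfold off in H1, H2. rewrite HFk in H1, H2. lra.
      + apply is_lim_seq_exp. now apply Hcorr.
    - apply is_lim_seq_exp_m_infty.
      apply is_lim_seq_le_m_loc with
        (fun i => (corr (psi i) k + dot d lx (A k)) + -1 * INR i).
      + exists O. intros i _. unfold r. rewrite Hc.
        destruct (HcM i k Hk) as [H1 _]. unfold off in H1. rewrite HFk in H1. lra.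
      + apply is_lim_seq_plus with (w0 k + dot d lx (A k)) m_infty; [auto| |easy].
        apply is_lim_seq_ext with (fun i => - INR i); [intros; ring|].
        apply (is_lim_seq_opp INR p_infty), is_lim_seq_INR. }
  assert (Hg : rsum n g <> 0).
  { apply Rgt_not_eq. unfold g.
    apply (weighted_sum_pos d n A F (fun k => exp (w0 k)) x).
    - intros. apply exp_pos.
    - now apply (reg_face_nonempty d n A lam). }
  destruct (eventually_l1dist_lt n _ _ eps (is_lim_seq_nrm n _ g Hlim Hg) He) as [N HN].
  apply (proj2 (H N)). exists (c N). rewrite l1dist_sym.
  eapply Rle_lt_trans; [|exact (HN N (le_n N))]. right. apply l1dist_ext.
  - intros k Hk.
    rewrite <- (nrm_scal n _ (exp (- snd (cM N)))).
    + apply nrm_ext; [easy|]. intros i Hi. unfold weights, r.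
      rewrite <- exp_plus. f_equal. ring.
    + apply Rgt_not_eq, exp_pos.
    + now apply Rgt_not_eq, weights_sum_pos.
  - intros k Hk. rewrite param_nrm. easy.
Qed.

(** Dividing by the largest weight makes each logarithmic coordinate converge in [[-oo, 0]]. The set
    [F] of finite limits is a face because the others fall arbitrarily far below. On [F] the limits
    differ from [w0] by an affine function, so their exponentials parametrise a point of the variety
    of [F]. *)
Lemma limit_of_normalised_weights d n A Q v lam corr w0 psi
  (c : nat -> nat -> R) (M : nat -> R) (s : nat -> Rbar) :
  (1 <= n)%nat -> tropical_limit n Q v lam corr w0 ->
  (forall F, exists P, incl P Q /\ cuts_weak_face d n A F P) ->
  extraction psi ->
  (forall i k, (k < n)%nat -> dot d (c i) (A k) + v (psi i) k <= M i) ->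
  (forall i, exists k, (k < n)%nat /\ dot d (c i) (A k) + v (psi i) k = M i) ->
  (forall k, (k < n)%nat ->
     is_lim_seq (fun i => dot d (c i) (A k) + v (psi i) k - M i) (s k)) ->
  exists z, X_complex d n A lam (fun k => exp (w0 k)) z /\
    forall k, (k < n)%nat ->
      is_lim_seq (fun i => nrm n (weights d A (c i) (v (psi i))) k) (z k).
Proof.
  intros Hn [Hcorr Htrop] HQ Hpsi HM HMeq Hs.
  set (f := fun i k => dot d (c i) (A k) + v (psi i) k - M i).
  (* The cut-off at [n] is the normalisation that [reg_face] demands. *)
  set (F := fun k => andb (Nat.ltb k n) (match s k with Finite _ => true | _ => false end)).
  set (sF := fun k => if F k then real (s k) else 0).
  assert (HFin : forall k, F k = true -> (k < n)%nat /\ s k = Finite (real (s k))).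
  { intros k HF. unfold F in HF. apply andb_prop in HF as [H1 H2].
    apply Nat.ltb_lt in H1. destruct (s k); easy. }
  assert (HFout : forall k, (k < n)%nat -> F k = false -> s k = m_infty).
  { intros k Hk HF. unfold F in HF. apply Nat.ltb_lt in Hk as Hk'. rewrite Hk' in HF.
    assert (Hle : Rbar_le (s k) 0).
    { apply is_lim_seq_le with (2 := Hs k Hk) (v := fun _ => 0).
      - intros i. specialize (HM i k Hk). lra.
      - apply is_lim_seq_const. }
    destruct (s k); easy. }
  assert (Hfall : forall k T, (k < n)%nat -> F k = false ->
            eventually (fun i => f i k < T)).
  { intros k T Hk HF. pose proof (Hs k Hk) as Hl. rewrite (HFout k Hk HF) in Hl.
    apply is_lim_seq_spec in Hl. apply Hl. }
  assert (Hne : exists k, (k < n)%nat /\ F k = true).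
  (* If every coordinate tended to [m_infty], all would eventually be negative, although the maximal
     one is always 0. *)
  { apply NNPP. intros Hno.
    destruct (eventually_forall_lt n (fun k i => f i k < 0)) as [N HN].
    - intros k Hk. apply Hfall; [easy|]. destruct (F k) eqn:HF; [|easy].
      exfalso. eauto.
    - destruct (HMeq N) as [k [Hk E]]. specialize (HN N (le_n N) k Hk).
      unfold f in HN. lra. }
  destruct (HQ F) as [P [HPQ HP]].
  set (g := fun i k => if F k then f i k else 0).
  assert (Hg : forall k, (k < n)%nat -> is_lim_seq (fun i => g i k) (sF k)).
  { intros k Hk. unfold g, sF. destruct (F k) eqn:HF.
    - rewrite <- (proj2 (HFin k HF)). now apply Hs.
    - apply is_lim_seq_const. }
  (* Removing the bounded defect [g] places [F] exactly on the hyperplane [(c i, M i)]; the other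
     points keep a gap that grows without bound. *)
  set (v' := fun i k => v (psi i) k + -1 * g i k).
  assert (Hgap : forall T, eventually (fun i =>
            weak_face d n A F (fun k => v' i k + T * off F k))).
  { intros T. destruct (eventually_forall_lt n (fun k i => F k = false -> f i k < - T))
      as [N HN].
    - intros k Hk. destruct (F k) eqn:HF.
      + now exists O.
      + destruct (Hfall k (- T) Hk HF) as [N HN]. exists N. auto.
    - exists N. intros i Hi. exists (c i), (M i). intros k Hk.
      specialize (HN i Hi k Hk). unfold v', g, off.
      destruct (F k); [|specialize (HN eq_refl)]; unfold f in *;
        (split; [|intros; try easy]); lra. }
  assert (Haff : forall i, affine_on d n A F (v' i)).
  { intros i. exists (c i), (M i). intros k Hk HF. unfold v', g. rewrite HF.
    unfold f. ring. }
  assert (Hv' : forall p i, dot n p (v (psi i)) = dot n p (v' i) + dot n p (g i)).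
  { intros p i. unfold v'. rewrite dot_plus_r, dot_scal_r. ring. }
  assert (Hpg : forall p, is_lim_seq (fun i => dot n p (g i)) (dot n p sF)).
  { intros p. now apply is_lim_seq_dot. }
  (* The limit [l] of [p(v)] is at most [p(sF) - T * p(off F)] for every [T]. Hence [l] is not
     [p_infty], and it is [m_infty] as soon as [p(off F) > 0]; [tropical_limit] turns this into
     signs of [p(lam)]. *)
  assert (Hneg : forall p, In p P -> dot n p lam <= 0 /\
            (0 < dot n p (off F) -> dot n p lam < 0)).
  { intros p Hp. destruct (Htrop p (HPQ p Hp)) as [l [Hl Hsgn]].
    apply (is_lim_seq_extraction _ _ psi Hpsi) in Hl.
    assert (Hle : forall T, eventually (fun i =>
              dot n p (v (psi i)) <= dot n p (g i) + - (T * dot n p (off F)))).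
    { intros T. destruct (Hgap T) as [N HN]. exists N. intros i Hi.
      pose proof (proj1 (HP _) (HN i Hi) p Hp) as Hi'.
      rewrite dot_plus_r, dot_scal_r in Hi'. rewrite Hv'. lra. }
    assert (HlT : forall T, Rbar_le l (dot n p sF + - (T * dot n p (off F)))).
    { intros T. eapply is_lim_seq_le_loc; [exact (Hle T)|exact Hl|].
      apply is_lim_seq_plus'; [apply Hpg|apply is_lim_seq_const]. }
    destruct l as [l| |]; [|exfalso; exact (HlT 0)|split; [lra|easy]].
    split; [lra|]. intros Hb. exfalso.
    (* With this [T] the upper bound equals [l - 1]. *)
    specialize (HlT ((dot n p sF - l + 1) / dot n p (off F))). simpl in HlT.
    unfold Rdiv in HlT. rewrite Rmult_assoc, Rinv_l in HlT; lra. }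
  assert (HF : reg_face d n A lam F).
  { apply reg_face_iff_gap; [easy|]. split; [|split; [easy|]].
    - intros k Hk. unfold F. destruct (Nat.ltb_spec k n); [lia|easy].
    - destruct (list_small_multiple P (fun p => dot n p lam) (fun p => dot n p (off F)))
        as [T [HT HPT]].
      + intros p Hp. now apply (dot_off_nonneg d n A F P).
      + intros p Hp. now apply Hneg.
      + intros p Hp. now apply Hneg.
      + exists T. split; [easy|]. apply HP. intros p Hp.
        rewrite dot_plus_r, dot_scal_r. auto. }
  assert (Hfit : affine_on d n A F (fun k => w0 k + -1 * sF k)).
  { apply (affine_on_polyhedral d n A F P _ HP). intros p Hp Hb.
    rewrite dot_plus_r, dot_scal_r.
    (* A form that ignores the coordinates outside [F] is nonpositive on both [v'] and its opposite,
       hence vanishes on [v']. Its limit on [v] is therefore the finite number [p(sF)], so it agrees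
       on [corr] and [v], whence [p(w0) = p(sF)]. *)
    assert (H0 : forall i, dot n p (v (psi i)) = dot n p (g i)).
    { intros i. rewrite Hv'.
      pose proof (proj1 (affine_on_polyhedral d n A F P _ HP) (Haff i) p Hp Hb).
      pose proof (proj1 (affine_on_polyhedral d n A F P _ HP)
                    (affine_on_opp _ _ _ _ _ (Haff i)) p Hp Hb) as H1.
      rewrite dot_scal_r in H1. lra. }
    destruct (Htrop p (HPQ p Hp)) as [l [Hl Hsgn]].
    pose proof (is_lim_seq_extraction _ _ psi Hpsi Hl) as Hl'.
    assert (E : l = dot n p sF).
    { apply is_lim_seq_unique in Hl'. rewrite <- Hl'. apply is_lim_seq_unique.
      apply is_lim_seq_ext with (2 := Hpg p). intros i. now rewrite H0. }
    rewrite E in Hl, Hsgn. destruct Hsgn as [_ Hc].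
    assert (E' : Finite (dot n p w0) = dot n p sF).
    { apply is_lim_seq_unique in Hl. rewrite <- Hl. symmetry. apply is_lim_seq_unique.
      apply is_lim_seq_ext with (fun j => dot n p (corr j)); [easy|].
      now apply is_lim_seq_dot. }
    injection E' as E'. lra. }
  destruct Hfit as [c' [M' Hfit]].
  (* On [F] one has [s k = w0 k + dot d c' (A k) - M'], so [exp c'] is the torus point sought and
     [exp (- M')] is a common scalar. *)
  exists (param d n A F (fun k => exp (w0 k)) (fun j => exp (c' j))). split.
  { exists F. split; [easy|]. apply param_in_X_Fw; [|easy|].
    - intros. apply exp_pos.
    - intros j _. apply exp_pos. }
  set (h := fun k => if F k then exp (w0 k) * mono d (A k) (fun j => exp (c' j)) else 0).
  assert (Hh : 0 < rsum n h).
  { apply (weighted_sum_pos d n A F (fun k => exp (w0 k))); [|easy].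
    intros. apply exp_pos. }
  intros k Hk. rewrite param_nrm. fold h.
  rewrite <- (nrm_scal n h (exp (- M'))); [|apply Rgt_not_eq, exp_pos|lra].
  apply is_lim_seq_ext with (fun i => nrm n (fun m => exp (f i m)) k).
  { intros i. rewrite <- (nrm_scal n (weights _ _ _ _) (exp (- M i))).
    - apply nrm_ext; [easy|]. intros m Hm. unfold weights, f.
      rewrite <- exp_plus. f_equal. ring.
    - apply Rgt_not_eq, exp_pos.
    - now apply Rgt_not_eq, weights_sum_pos. }
  apply is_lim_seq_nrm; [|rewrite rsum_scal|easy].
  - intros m Hm. unfold h. destruct (F m) eqn:HFm.
    + rewrite mono_exp, <- !exp_plus. apply is_lim_seq_exp.
      pose proof (Hs m Hm) as Hsm. rewrite (proj2 (HFin m HFm)) in Hsm.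
      specialize (Hfit m Hm HFm). unfold sF in Hfit. rewrite HFm in Hfit.
      replace (- M' + (w0 m + dot d c' (A m))) with (real (s m)) by lra. exact Hsm.
    + rewrite Rmult_0_r. apply is_lim_seq_exp_m_infty.
      rewrite <- (HFout m Hm HFm). now apply Hs.
  - apply Rmult_integral_contrapositive. split; [apply Rgt_not_eq, exp_pos|lra].
Qed.

(** Any choice of slopes [c] is admissible: [M] is taken as the maximal exponent, and a further
    subsequence makes the finitely many differences converge in the extended reals. *)
Lemma limit_points_in_complex d n A Q v lam corr w0 psi (c : nat -> nat -> R) :
  (1 <= n)%nat -> tropical_limit n Q v lam corr w0 ->
  (forall F, exists P, incl P Q /\ cuts_weak_face d n A F P) ->
  extraction psi ->
  exists theta z, extraction theta /\ X_complex d n A lam (fun k => exp (w0 k)) z /\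
    forall k, (k < n)%nat -> is_lim_seq
      (fun i => nrm n (weights d A (c (theta i)) (v (psi (theta i)))) k) (z k).
Proof.
  intros Hn Htrop HQ Hpsi.
  destruct (functional_choice (fun i M =>
      (forall k, (k < n)%nat -> dot d (c i) (A k) + v (psi i) k <= M) /\
      (exists k, (k < n)%nat /\ dot d (c i) (A k) + v (psi i) k = M))) as [M HM].
  { intros i. destruct (exists_argmax n (fun k => dot d (c i) (A k) + v (psi i) k) Hn)
      as [k [Hk Hmax]].
    exists (dot d (c i) (A k) + v (psi i) k). split; [easy|now exists k]. }
  destruct (exists_jointly_convergent_subsequence (seq 0 n)
    (fun k i => dot d (c i) (A k) + v (psi i) k - M i)) as [theta [Htheta Hlim]].
  destruct (functional_choice (fun k (l : Rbar) => (k < n)%nat -> is_lim_seq (fun i =>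
      dot d (c (theta i)) (A k) + v (psi (theta i)) k - M (theta i)) l)) as [s Hs].
  { intros k. destruct (Nat.lt_ge_cases k n) as [Hk|Hk].
    - destruct (Hlim k) as [l Hl]; [apply in_seq; lia|]. now exists l.
    - exists 0. lia. }
  destruct (limit_of_normalised_weights d n A Q v lam corr w0 (fun i => psi (theta i))
     (fun i => c (theta i)) (fun i => M (theta i)) s) as [z [Hz HL]]; auto.
  - now apply extraction_comp.
  - intros i. apply HM.
  - intros i. apply HM.
  - exists theta, z. auto.
Qed.

(** * Compactness of the simplex and Hausdorff convergence *)

Lemma simplex_coord_bound n z k :
  in_simplex n z -> (k < n)%nat -> 0 <= z k <= 1.
Proof.
  intros [H1 H2] Hk. split; [auto|]. rewrite <- H2. now apply rsum_ge_term.
Qed.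

Lemma simplex_convergent_subsequence n (x : nat -> nat -> R) :
  (forall i, in_simplex n (x i)) ->
  exists theta (l : nat -> R), extraction theta /\
    forall k, (k < n)%nat -> is_lim_seq (fun i => x (theta i) k) (l k).
Proof.
  intros Hx.
  destruct (exists_jointly_convergent_subsequence (seq 0 n) (fun k i => x i k))
    as [theta [Htheta Hlim]].
  destruct (functional_choice (fun k (l : R) => (k < n)%nat -> is_lim_seq (fun i => x (theta i) k) l))
    as [l Hl].
  { intros k. destruct (Nat.lt_ge_cases k n) as [Hk|Hk]; [|exists 0; lia].
    destruct (Hlim k) as [l Hl]; [apply in_seq; lia|].
    assert (H0 : Rbar_le 0 l).
    { apply is_lim_seq_le with (u := fun _ => 0) (3 := Hl); [|apply is_lim_seq_const].
      intros i. now apply (simplex_coord_bound n). }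
    assert (H1 : Rbar_le l 1).
    { apply is_lim_seq_le with (v := fun _ => 1) (2 := Hl); [|apply is_lim_seq_const].
      intros i. now apply (simplex_coord_bound n). }
    destruct l as [l| |]; [now exists l|easy|easy]. }
  exists theta, l. auto.
Qed.

Theorem mainTheorem8 :
  forall (d n : nat) (A : nat -> nat -> R),
    (1 <= n)%nat ->
    (forall k1 k2, (k1 < n)%nat -> (k2 < n)%nat -> k1 <> k2 ->
       exists j, (j < d)%nat /\ A k1 j <> A k2 j) ->
    forall ws : nat -> nat -> R,
    (forall i k, (k < n)%nat -> 0 < ws i k) ->
    exists (phi : nat -> nat) (lam w : nat -> R),
      (forall j, (phi j < phi (S j))%nat) /\
      (forall k, (k < n)%nat -> 0 < w k) /\
      hausdorff_lim n (fun j => act_set n (ws (phi j)) (X_A d n A))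
                      (X_complex d n A lam w).
Proof.
  intros d n A Hn _ ws Hws.
  destruct (weak_faces_polyhedral d n A) as [Q HQ].
  destruct (exists_tropical_limit n Q (fun i k => ln (ws i k)))
    as [phi [lam [corr [w0 [Hphi Htrop]]]]].
  exists phi, lam, (fun k => exp (w0 k)). split; [exact Hphi|].
  split; [intros; apply exp_pos|]. intros eps He.
  cut (eventually (fun j => forall y, act_set n (ws (phi j)) (X_A d n A) y ->
         exists x, X_complex d n A lam (fun k => exp (w0 k)) x /\ l1dist n y x < eps) /\
       eventually (fun j => forall x, X_complex d n A lam (fun k => exp (w0 k)) x ->
         exists y, act_set n (ws (phi j)) (X_A d n A) y /\ l1dist n x y < eps)).
  { intros [[N1 H1] [N2 H2]]. exists (N1 + N2)%nat. intros j Hj.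
    split; [apply H1|apply H2]; lia. }
  split.
  (* Translates near the complex: otherwise infinitely many translates contain a point at distance
     at least [eps] from it. Replacing each by a monomial point costs [eps / 2], and a subsequence
     of these converges into the complex, a contradiction. *)
  - apply NNPP. intros Hnot. pose proof (not_eventually _ Hnot) as Hinf.
    destruct (extract_subsequence (fun _ m => exists c, forall x,
        X_complex d n A lam (fun k => exp (w0 k)) x ->
        eps / 2 <= l1dist n (nrm n (weights d A c (fun k => ln (ws (phi m) k)))) x))
      as [psi [Hpsi Hfar]].
    { intros _ N. destruct (Hinf N) as [m [Hm Hbad]]. exists m. split; [easy|].
      apply not_all_ex_not in Hbad as [y Hy]. apply imply_to_and in Hy as [Hy Hyfar].
      destruct (act_set_approx d n A (ws (phi m)) y (eps / 2)) as [c Hc];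
        auto; [lra|].
      exists c. intros x Hx. apply Rnot_lt_le. intros Hlt. apply Hyfar.
      exists x. split; [easy|]. eapply Rle_lt_trans; [eapply l1dist_triangle|].
      apply Rlt_le_trans with (eps / 2 + eps / 2); [|lra].
      apply Rplus_lt_compat; eassumption. }
    apply functional_choice in Hfar as [c Hfar].
    destruct (limit_points_in_complex d n A Q (fun j k => ln (ws (phi j) k))
      lam corr w0 psi c) as [theta [z [Htheta [Hz Hlim]]]]; auto.
    destruct (eventually_l1dist_lt n _ _ (eps / 2) Hlim) as [N HN]; [lra|].
    exact (Rlt_not_le _ _ (HN N (le_n N)) (Hfar (theta N) z Hz)).
  (* Complex near the translates: bad points [x i] of the complex accumulate at some [l] by
     compactness. One fixed [x (theta N)] near [l], replaced by a monomial point [q] of its face, is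
     approximated by all late translates. The path from [x (theta i)] through [l], [x (theta N)] and
     [q] has four steps shorter than [eps / 4]. *)
  - apply NNPP. intros Hnot. pose proof (not_eventually _ Hnot) as Hinf.
    destruct (extract_subsequence (fun _ m => exists x,
        X_complex d n A lam (fun k => exp (w0 k)) x /\
        forall y, act_set n (ws (phi m)) (X_A d n A) y -> eps <= l1dist n x y))
      as [psi [Hpsi Hfar]].
    { intros _ N. destruct (Hinf N) as [m [Hm Hbad]]. exists m. split; [easy|].
      apply not_all_ex_not in Hbad as [x Hx]. apply imply_to_and in Hx as [Hx Hxfar].
      exists x. split; [easy|]. intros y Hy. apply Rnot_lt_le. intros Hlt.
      apply Hxfar. now exists y. }
    apply functional_choice in Hfar as [x Hfar].
    destruct (simplex_convergent_subsequence n x) as [theta [l [Htheta Hl]]].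
    { intros i. destruct (proj1 (Hfar i)) as [F [_ [[Hx _] _]]]. exact Hx. }
    destruct (eventually_l1dist_lt n _ _ (eps / 4) Hl) as [N HN]; [lra|].
    destruct (proj1 (Hfar (theta N))) as [F [HF [_ Hcl]]].
    destruct (Hcl (eps / 4)) as [q [[t [Ht ->]] Hq]]; [lra|].
    destruct (HQ F) as [P [HPQ HP]].
    destruct (face_points_approximated d n A Q (fun j k => ln (ws (phi j) k))
      lam corr w0 F P t (eps / 4)) as [N' HN']; auto; [lra|].
    (* Extractions dominate the identity, so this [i] passes the threshold [N] while [psi (theta i)]
       passes [N']. *)
    set (i := (N + N')%nat).
    pose proof (extraction_ge_id theta i Htheta) as Hi1.
    pose proof (extraction_ge_id psi (theta i) Hpsi) as Hi2.
    destruct (HN' (psi (theta i))) as [c Hc]; [lia|].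
    pose proof (proj2 (Hfar (theta i)) _
      (weights_in_act_set d n A (ws (phi (psi (theta i)))) c Hn (Hws _))) as Hge.
    assert (HNN : l1dist n (x (theta N)) l < eps / 4) by exact (HN N (le_n N)).
    assert (HNi : l1dist n (x (theta i)) l < eps / 4) by (apply (HN i); lia).
    set (y := nrm n (weights d A c (fun k => ln (ws (phi (psi (theta i))) k)))) in *.
    set (q := param d n A F (fun k => exp (w0 k)) t) in *.
    pose proof (l1dist_triangle n (x (theta i)) l y).
    pose proof (l1dist_triangle n l (x (theta N)) y).
    pose proof (l1dist_triangle n (x (theta N)) q y).
    rewrite (l1dist_sym n (x (theta N)) l) in HNN. lra.
Qed.
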